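(* Let $t\ge 2$ be an integer, let $(m,k)$ be integers with $k\ge2$, $0<m<k$, $\gcd(m,k)=1$, and put $n=tk$. Define the canonical pair $(m_1,k_1),(m_2,k_2)$ by $$k_1=m^{-1}\bmod k,\qquad m_1=\frac{mk_1-1}{k},\qquad (m_2,k_2)=(m-m_1,\;k-k_1).$$ (1) (Farey parents.) The canonical pair is a Farey-adjacent pair of admissible parameters; it is the unique Farey-adjacent pair of admissible parameters with mediant $m/k$; and its fan-twist splice reproduces the prototile of $(m,k)$. (2) (Rigidity.) Conversely, suppose that for some cut position $1\le k_1'\le k-1$ and some admissible parameters $(m_1',k_1')$, $(m_2',k_2')$ with $k_2'=k-k_1'$ (seeds allowed; Farey adjacency not assumed), the fan-twist splice of $(m_1',k_1')$ and $(m_2',k_2')$ reproduces the lower path of $(m,k)$. Then $k_1'=k_1$, and for each $i\in\{1,2\}$ with $k_i'\ge2$ one has $m_i'=m_i$. (A block with $k_i'=1$ is realized by either of the seeds $(0,1)$, $(1,1)$.) In particular, the prototile of $(m,k)$ admits exactly one fan-twist splice decomposition, and a fan-twist splice of two prototiles of the family reproduces a prototile of the family only if the parameters are Farey-adjacent; in both assertions the two seeds, which give the same block, are not distinguished, so that for a block with $k_i'=1$ the parameter is taken to be the canonical seed $m_i'=m_i$.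
   Context: An admissible parameter is a pair of integers $(m,k)$ that either satisfies $0<m<k$ and $\gcd(m,k)=1$ (a reduced parameter), or is one of the two formal seeds $(0,1)$, $(1,1)$. An (ordered) pair $(m_1,k_1),(m_2,k_2)$ of admissible parameters with $m_1/k_1<m_2/k_2$ is Farey-adjacent if $m_2k_1-m_1k_2=1$; its mediant is $(m_1+m_2)/(k_1+k_2)$, identified with the parameter $(m_1+m_2,k_1+k_2)$. For $\gcd(m,k)=1$, $k\ge2$, $m^{-1}\bmod k$ is the unique integer in $\{1,\dots,k-1\}$ whose product with $m$ is $\equiv1\pmod k$. Fix $t\ge2$. For admissible $(m,k)$ put $n=tk$, $v_n(d)=(\cos\frac{2\pi d}{n},\sin\frac{2\pi d}{n})$, $s_j=jm\bmod k\in\{0,\dots,k-1\}$ for $0\le j\le k-1$. The lower path of $(m,k)$ is the polygonal path starting at the origin and successively appending the unit edges $v_n(s_0),\dots,v_n(s_{k-1}),v_n(k)$; the last edge, of direction angle $2\pi/t$, is the terminal edge. The upper path is built in the same way from the word obtained from $(s_0,\dots,s_{k-1},k)$ by exchanging its first and last entries; the $(m,k)$-prototile is the closed polygon bounded by the lower and upper paths. It is determined by the lower path. Fan-twist splice: given admissible parameters $(m_1',k_1')$, $(m_2',k_2')$, with $k=k_1'+k_2'$ and $n=tk$, their fan-twist splice is the path obtained by concatenating, starting from the origin, (i) the edges $j=0,\dots,k_1'-1$ of the lower path of $(m_1',k_1')$, edge $j$ rotated by $+j\cdot\frac{2\pi}{k_1'n}$; (ii) the edges $i=0,\dots,k_2'-1$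 of the lower path of $(m_2',k_2')$, edge $i$ rotated by $+\frac{2\pi}{n}-i\cdot\frac{2\pi}{k_2'n}$; (iii) the terminal edge of direction angle $2\pi/t$. The splice reproduces the lower path (equivalently, the prototile) of $(m,k)$ if it coincides vertex by vertex with the lower path of $(m,k)$; this is called a fan-twist splice decomposition of the prototile of $(m,k)$, with cut position $k_1'$. *)

(* Defs.v *)
From mathcomp Require Import all_boot all_order all_algebra.
From mathcomp Require Import reals trigo.

Set Implicit Arguments.
Unset Strict Implicit.
Unset Printing Implicit Defensive.

Import Order.TTheory GRing.Theory Num.Theory.

Local Open Scope ring_scope.

(* A parameter (m, k).  Natural numbers lose nothing: the entries of an
   admissible parameter are nonnegative integers. *)
Definition param := (nat * nat)%type.

Definition reduced (p : param) : bool := (0 < p.1 < p.2)%N && coprime p.1 p.2.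

Definition seed (p : param) : bool := (p == (0, 1)%N) || (p == (1, 1)%N).

Definition admissible (p : param) : bool := reduced p || seed p.

Definition slope (p : param) : rat := p.1%:R / p.2%:R.

Definition farey_adjacent (p q : param) : Prop :=
  [/\ admissible p, admissible q, slope p < slope q
    & (q.1 * p.2)%N%:Z - (p.1 * q.2)%N%:Z = 1].

Definition mediant (p q : param) : param := (p.1 + q.1, p.2 + q.2)%N.

Definition modinv (m k : nat) : nat :=
  head 0%N [seq x <- iota 1 k.-1 | m * x == 1 %[mod k]].

Lemma modinvP (m k : nat) : (1 < k)%N -> coprime m k ->
  [/\ (0 < modinv m k < k)%N, m * modinv m k = 1 %[mod k]
    & forall x : nat, (0 < x < k)%N -> m * x = 1 %[mod k] -> x = modinv m k].
Proof.
move=> k1 co; have k0 : (0 < k)%N by apply: ltnW.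
have memE x : (x \in [seq x <- iota 1 k.-1 | m * x == 1 %[mod k]]) =
    (m * x == 1 %[mod k]) && (0 < x < k)%N.
  by rewrite mem_filter mem_iota add1n prednK.
have inj x y : (0 < x < k)%N -> (0 < y < k)%N ->
    m * x = 1 %[mod k] -> m * y = 1 %[mod k] -> x = y.
  move=> /andP[_ xk] /andP[_ yk] hx hy.
  have e : x = y %[mod k].
    have hxy : x * (m * y) = x %[mod k] by rewrite -modnMmr hy modnMmr muln1.
    have hyx : y * (m * x) = y %[mod k] by rewrite -modnMmr hx modnMmr muln1.
    by rewrite -hxy -hyx mulnCA [in RHS]mulnCA [(x * y)%N]mulnC.
  by move: e; rewrite !modn_small.
have [u hu] : exists u, (m * u = 1 %[mod k])%N.
  case: m co {memE inj} => [|m] co.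
    by move: co k1; rewrite /coprime gcd0n => /eqP ->.
  case: (@egcdnP m.+1 k (ltn0Sn _)) => u v e _; exists u.
  by rewrite mulnC e (eqP co) modnMDl.
have hmem : (u %% k)%N \in [seq x <- iota 1 k.-1 | m * x == 1 %[mod k]].
  rewrite memE modnMmr hu eqxx ltn_pmod // andbT /= lt0n.
  apply/eqP => u0; move: hu.
  by rewrite -modnMmr u0 muln0 mod0n modn_small.
have : modinv m k \in [seq x <- iota 1 k.-1 | m * x == 1 %[mod k]].
  by rewrite /modinv; case: [seq _ <- _ | _] hmem => //= a s _; exact: mem_head.
rewrite memE => /andP[/eqP h b]; split=> // x bx hx.
exact: inj.
Qed.

(* For coprime 0 < m < k the division below is exact and none of the
   subtractions is truncated. *)
Definition canonical1 (r : param) : param :=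
  let k1 := modinv r.1 r.2 in ((r.1 * k1 - 1) %/ r.2, k1)%N.

Definition canonical2 (r : param) : param :=
  (r.1 - (canonical1 r).1, r.2 - (canonical1 r).2)%N.

Section Paths.
Variable R : realType.

Definition dir (a : R) : R * R := (cos a, sin a).

Definition vdir (n d : nat) : R * R := dir (2 * pi * d%:R / n%:R).

Definition rotate (a : R) (v : R * R) : R * R :=
  (cos a * v.1 - sin a * v.2, sin a * v.1 + cos a * v.2).

Definition vertices (edges : seq (R * R)) : seq (R * R) :=
  0 :: scanl +%R 0 edges.

Definition lower_edges (t : nat) (p : param) : seq (R * R) :=
  rcons [seq vdir (t * p.2) (j * p.1 %% p.2) | j <- iota 0 p.2]
        (vdir (t * p.2) p.2).

Definition lower_path (t : nat) (p : param) : seq (R * R) :=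
  vertices (lower_edges t p).

(* In the two blocks n is the order t * k of the spliced path, whereas
   lower_edges t p is drawn with the order t * p.2 of its own parameter. *)
Definition first_block (n t : nat) (p : param) : seq (R * R) :=
  [seq rotate (j%:R * (2 * pi / (p.2 * n)%:R)) (nth 0 (lower_edges t p) j)
     | j <- iota 0 p.2].

Definition second_block (n t : nat) (p : param) : seq (R * R) :=
  [seq rotate (2 * pi / n%:R - i%:R * (2 * pi / (p.2 * n)%:R))
              (nth 0 (lower_edges t p) i)
     | i <- iota 0 p.2].

Definition splice (t : nat) (p q : param) : seq (R * R) :=
  let n := (t * (p.2 + q.2))%N in
  vertices (rcons (first_block n t p ++ second_block n t q)
                  (dir (2 * pi / t%:R))).

(* The prototile of r is determined by its lower path (the upper path has the
   same edges with the first and the last exchanged), so reproducing the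
   prototile means reproducing the lower path, vertex by vertex. *)
Definition reproduces (t : nat) (p q r : param) : Prop :=
  splice t p q = lower_path t r.

(* The cut position of the decomposition pq is pq.1.2. *)
Definition decomposition (t : nat) (r : param) (pq : param * param) : Prop :=
  [/\ admissible pq.1, admissible pq.2, (pq.1.2 + pq.2.2)%N = r.2
    & reproduces t pq.1 pq.2 r].

End Paths.

(* The two seeds are not distinguished: a parameter with denominator 1 is
   replaced by the one with the numerator prescribed by the canonical pair. *)
Definition set_seed (c p : param) : param :=
  if p.2 == 1%N then (c.1, 1%N) else p.

Definition set_seeds (r : param) (pq : param * param) : param * param :=
  (set_seed (canonical1 r) pq.1, set_seed (canonical2 r) pq.2).

(* Main.v *)
Require Import Defs.
From mathcomp Require Import all_boot all_order all_algebra.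
From mathcomp Require Import reals trigo.
From mathcomp Require Import ring lra zify.

Set Implicit Arguments.
Unset Strict Implicit.
Unset Printing Implicit Defensive.

Import Order.TTheory GRing.Theory Num.Theory.

(** The theorem is a statement about integers once each edge is replaced by
    its direction angle.  Write p = (m1, k1), q = (m2, k2), r = (m, k) with
    k = k1 + k2, n = tk, and measure all angles of block i in units of
    2 pi / (n ki).  Edge j of the first block then has the integer angle
    k (j m1 mod k1) + j, edge i of the second block has the integer angle
    k (i m2 mod k2) + k2 - i, and both lie in [0, k ki), that is within a
    1/t-th of a full turn.  Unit vectors determine their angle modulo a full
    turn, and a path determines its edges, so the splice reproduces the lower
    path of r iff these integers are equal to ki times the words of r:

      k (j m1 mod k1) + j      = k1 (j m mod k)           for 0 <= j < k1,
      k (i m2 mod k2) + k2 - i = k2 ((k1 + i) m mod k)    for 0 <= i < k2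

    ([reproducesP], [splice_equations]).

    The rigidity is read off from very few of these equations.  The first edge
    of the second block (i = 0) says (k1 m) mod k = 1, so that k1 is the inverse
    of m; the second edge of each block (index 1) says k m1 + 1 = k1 m and
    k m2 = k2 m + 1, which determines m1 and m2 ([splice_equations_canonical]).
    A block of denominator 1 has no such edge, and its only edge does not see
    the numerator: there the seeds (0, 1) and (1, 1) cannot be told apart.

    Conversely k m1 + 1 = k1 m and k m2 = k2 m + 1, which hold for the
    canonical pair, make all the equations true: if j m1 = a k1 + s with s < k1,
    then k1 (j m - k a) = k s + j lies in [0, k k1), so that j m - k a is the
    residue of j m modulo k, and similarly in the second block
    ([canonical_splice_equations]).  The same two identities give the Farey
    adjacency of the canonical pair, and m k1 - m1 k = 1 holds for every Farey
    pair with mediant m/k, whence its uniqueness. *)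

(** * Edges and their directions *)

Section Directions.
Local Open Scope ring_scope.
Variable R : realType.

(** Equal unit vectors have angles whose difference d satisfies
    [1 = cos d = 1 - 2 sin^2 (d / 2)]; but sine is positive on ]0, pi[. *)
Lemma dir_inj_turn (x y : R) : 0 <= x < 2 * pi -> 0 <= y < 2 * pi ->
  dir x = dir y -> x = y.
Proof.
wlog le_yx : x y / y <= x => [hw hx hy e|].
  have [le_yx|/ltW le_xy] := leP y x; first exact: hw.
  by apply/esym/hw.
move=> /andP[x0 x2] /andP[y0 y2] [ec es].
have cos1 : cos (x - y) = 1 by rewrite cosB ec es -!expr2 cos2Dsin2.
have sin0 : sin ((x - y) / 2) = 0.
  have : cos ((x - y) / 2 *+ 2) = 1.
    by rewrite mulr2n -splitr.
  rewrite cos_mulr2n => cos1'; have cs := cos2Dsin2 ((x - y) / 2).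
  by apply/eqP; rewrite -sqrf_eq0; apply/eqP; lra.
apply/eqP; rewrite eq_le le_yx andbT leNgt; apply/negP => lt_yx.
have : 0 < sin ((x - y) / 2) by apply: sin_gt0_pi; apply/andP; split; lra.
by rewrite sin0 ltxx.
Qed.

Lemma vdir_inj (n a b : nat) : (a < n)%N -> (b < n)%N ->
  vdir R n a = vdir R n b -> a = b.
Proof.
move=> an bn.
have n0 : 0 < n%:R :> R by rewrite ltr0n; lia.
have pi0 := pi_gt0 R.
have bnd c : (c < n)%N -> 0 <= 2 * @pi R * c%:R / n%:R < 2 * @pi R.
  move=> cn; apply/andP; split.
    by rewrite !mulr_ge0 ?invr_ge0 ?ler0n ?pi_ge0.
  by rewrite ltr_pdivrMr // ltr_pM2l ?ltr_nat // mulr_gt0.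
move/(dir_inj_turn (bnd _ an) (bnd _ bn)).
move/(mulIf (invr_neq0 (lt0r_neq0 n0))).
have pi2 : 2 * pi != 0 :> R by rewrite lt0r_neq0 // mulr_gt0.
by move/(mulfI pi2)/eqP; rewrite eqr_nat => /eqP.
Qed.

Lemma vdir_scale (n a c : nat) : (0 < n)%N -> (0 < c)%N ->
  vdir R (n * c) (c * a) = vdir R n a.
Proof.
move=> n0 c0; congr dir; rewrite !natrM; field.
by rewrite !pnatr_eq0 -!lt0n n0 c0.
Qed.

Lemma rotate_dir (a b : R) : rotate a (dir b) = dir (a + b).
Proof. by rewrite /rotate /dir /= cosD sinD. Qed.

Lemma nth_lower_edges (t : nat) (p : param) (j : nat) : (j < p.2)%N ->
  nth 0 (lower_edges R t p) j = vdir R (t * p.2) (j * p.1 %% p.2).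
Proof.
move=> jp; rewrite nth_rcons size_map size_iota jp.
by rewrite (nth_map 0%N) ?size_iota // nth_iota.
Qed.

Lemma first_blockE (t k : nat) (p : param) :
    (0 < t)%N -> (0 < k)%N -> (0 < p.2)%N ->
  first_block R (t * k) t p =
    [seq vdir R (t * k * p.2) (k * (j * p.1 %% p.2) + j) | j <- iota 0 p.2].
Proof.
move=> t0 k0 p0; apply/eq_in_map => j; rewrite mem_iota add0n => /andP[_ jp].
rewrite nth_lower_edges // rotate_dir; congr dir.
rewrite !(natrM, natrD); field.
by rewrite !pnatr_eq0 -!lt0n p0 k0 t0.
Qed.

Lemma second_blockE (t k : nat) (p : param) :
    (0 < t)%N -> (0 < k)%N -> (0 < p.2)%N ->
  second_block R (t * k) t p =
    [seq vdir R (t * k * p.2) (k * (i * p.1 %% p.2) + (p.2 - i))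
       | i <- iota 0 p.2].
Proof.
move=> t0 k0 p0; apply/eq_in_map => i; rewrite mem_iota add0n => /andP[_ ip].
rewrite nth_lower_edges // rotate_dir; congr dir.
rewrite !(natrM, natrD) natrB ?(ltnW ip) //; field.
by rewrite !pnatr_eq0 -!lt0n p0 k0 t0.
Qed.

Lemma vertices_inj : injective (@vertices R).
Proof.
move=> s1 s2 []; move: (0 : R * R) => x.
elim: s1 s2 x => [|a s1 IH] [|b s2] x // /eqP.
by rewrite eqseq_cons => /andP[/eqP/addrI-> /eqP/IH->].
Qed.

End Directions.

(** * Reduction to integers *)

(** Both sides are integer angles, in units of [2 pi / (n l)] with [l] the
    denominator of the block and [n] the order of the spliced path: on the left
    the rotated edge of the block, on the right the edge of the lower path. *)
Definition splice_equations (p q r : param) : Prop :=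
  (forall j, j < p.2 -> r.2 * (j * p.1 %% p.2) + j = p.2 * (j * r.1 %% r.2)) /\
  (forall i, i < q.2 ->
     r.2 * (i * q.1 %% q.2) + (q.2 - i) = q.2 * ((p.2 + i) * r.1 %% r.2)).

(** An integer angle [c] of a block with denominator [l] stays below
    [t * k * l], i.e. below a full turn, so directions compare as integers. *)
Lemma vdir_refine (R : realType) (t k l c d : nat) :
    0 < t -> 0 < k -> 0 < l -> c < k * l ->
  vdir R (t * k * l) c = vdir R (t * k) (d %% k) <-> c = l * (d %% k).
Proof.
move=> t0 k0 l0 ckl; have tk0 : 0 < t * k by rewrite muln_gt0 t0.
have dk := ltn_pmod d k0.
have hl : k * l <= t * k * l by rewrite -mulnA leq_pmull.
rewrite -(vdir_scale R (d %% k) tk0 l0); split=> [|-> //].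
apply: vdir_inj; first exact: leq_trans hl.
by apply: leq_trans hl; rewrite mulnC ltn_pmul2r.
Qed.

Lemma reproducesP (R : realType) (t : nat) (p q r : param) :
    0 < t -> 0 < p.2 -> 0 < q.2 ->
  reproduces R t p q r <-> p.2 + q.2 = r.2 /\ splice_equations p q r.
Proof.
move=> t0 p0 q0.
have size_eq : reproduces R t p q r -> p.2 + q.2 = r.2.
  move/vertices_inj/(congr1 size).
  by rewrite !size_rcons size_cat !size_map !size_iota => -[].
suff key : p.2 + q.2 = r.2 -> reproduces R t p q r <-> splice_equations p q r.
  split=> [h|[e h]]; last exact/(key e).
  by split; [exact: size_eq | apply/key => //; exact: size_eq].
move=> e; have k0 : 0 < r.2 by rewrite -e addn_gt0 p0.
have last_edge : dir (2 * pi / t%:R)%R = vdir R (t * r.2) r.2.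
  by have := vdir_scale R 1 t0 k0; rewrite muln1 => ->; rewrite /vdir mulr1.
have bound l i s : i <= l -> s < l -> l < r.2 -> r.2 * s + i < r.2 * l.
  by move=> *; nia.
have edges : reproduces R t p q r <->
    first_block R (t * r.2) t p ++ second_block R (t * r.2) t q =
    [seq vdir R (t * r.2) (j * r.1 %% r.2) | j <- iota 0 r.2].
  rewrite /reproduces /splice /lower_path e last_edge.
  split=> [/vertices_inj/rcons_inj[]|h] //.
  by congr (vertices (rcons _ _)).
rewrite edges -[in iota 0 r.2]e iotaD add0n map_cat -[in iota p.2 _](addn0 p.2).
rewrite iotaDl -map_comp first_blockE // second_blockE //.
have cat_iff (a b c d : seq (R * R)) : size a = size c ->
    a ++ b = c ++ d <-> a = c /\ b = d.
  move=> sz; split=> [/eqP|[-> ->] //].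
  by rewrite eqseq_cat // => /andP[/eqP-> /eqP->].
rewrite cat_iff ?size_map //.
(* One block against the matching segment, starting at position d, of the
   lower path. *)
have wordP l d (f : nat -> nat) : 0 < l -> (forall i, i < l -> f i < r.2 * l) ->
    [seq vdir R (t * r.2 * l) (f i) | i <- iota 0 l] =
      [seq vdir R (t * r.2) ((d + i) * r.1 %% r.2) | i <- iota 0 l] <->
    (forall i, i < l -> f i = l * ((d + i) * r.1 %% r.2)).
  move=> l0 f_lt; split=> [/eq_in_map h i il|h].
    by apply/(vdir_refine R _ t0 k0 l0 (f_lt _ il))/h; rewrite mem_iota.
  apply/eq_in_map => i; rewrite mem_iota add0n => /andP[_ il].
  by apply/(vdir_refine R _ t0 k0 l0 (f_lt _ il))/h.
have f1_lt j : j < p.2 -> r.2 * (j * p.1 %% p.2) + j < r.2 * p.2.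
  by move=> jp; apply: bound => //; rewrite ?ltn_pmod //; lia.
have f2_lt i : i < q.2 -> r.2 * (i * q.1 %% q.2) + (q.2 - i) < r.2 * q.2.
  by move=> iq; apply: bound; rewrite ?ltn_pmod ?leq_subr //; lia.
by split=> -[/(wordP _ 0 _ p0 f1_lt) h1 /(wordP _ p.2 _ q0 f2_lt) h2].
Qed.

(** * Farey arithmetic *)

Lemma admissible_gt0 (p : param) : admissible p -> 0 < p.2.
Proof.
case: p => a b /or3P[/andP[/andP[_ /= +] _]|/eqP[_ ->]|/eqP[_ ->]] //.
by case: b.
Qed.

Lemma admissible_reduced (p : param) : admissible p -> 2 <= p.2 -> reduced p.
Proof. by case: p => a b /or3P[//|/eqP[_ ->]|/eqP[_ ->]]. Qed.

Lemma coprime_bezout (a b x y : nat) : a * x = b * y + 1 -> coprime a b.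
Proof.
move=> e; have : gcdn a b %| b * y + 1 by rewrite -e dvdn_mulr ?dvdn_gcdl.
by rewrite dvdn_addr ?dvdn_mulr ?dvdn_gcdr // dvdn1.
Qed.

(** The division in [canonical1] is exact, so the canonical parameter is the
    one solution of [k m1 + 1 = k1 m] with [0 < k1 < k]: modulo [k] this says
    that [k1] is the inverse of [m], and then it determines [m1]. *)
Lemma canonical1P (r p : param) : reduced r ->
  p = canonical1 r <-> 0 < p.2 < r.2 /\ r.2 * p.1 + 1 = p.2 * r.1.
Proof.
case: r p => m k [m1 k1] /andP[/= /andP[m0 mk] co].
have k2 : 1 < k by lia.
have [inv_lt inv_mod inv_uniq] := modinvP k2 co.
have bezout c : 0 < m * c -> m * c = 1 %[mod k] -> k * ((m * c - 1) %/ k) + 1 = c * m.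
  move=> mc0 /eqP; rewrite eqn_mod_dvd // => /divnK.
  by rewrite mulnC => ->; lia.
split=> [[-> ->]|[k1_lt e]].
  by split=> //; apply: bezout => //; nia.
have k1E : k1 = modinv m k.
  by apply: inv_uniq => //; rewrite mulnC -e mulnC modnMDl.
rewrite /canonical1 /= -k1E; congr pair.
by rewrite mulnC -e addnK mulKn //; lia.
Qed.

Lemma canonicalP (r : param) (p := canonical1 r) (q := canonical2 r) :
    reduced r ->
  [/\ 0 < p.2, 0 < q.2, mediant p q = r, r.2 * p.1 + 1 = p.2 * r.1
    & r.2 * q.1 = q.2 * r.1 + 1].
Proof.
move=> rr; have [/andP[p0 pr] e] := (canonical1P p rr).1 erefl.
have [/andP[m0 mk] _] := andP rr.
have le1 : p.1 <= r.1 by nia.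
have q1E : q.1 = r.1 - p.1 by [].
have q2E : q.2 = r.2 - p.2 by [].
split=> //; first by rewrite q2E subn_gt0.
  rewrite /mediant q1E q2E !subnKC ?(ltnW pr) //.
  by case: (r).
by rewrite q1E q2E mulnBr mulnBl; nia.
Qed.

Lemma canonical_farey (r : param) : reduced r ->
  farey_adjacent (canonical1 r) (canonical2 r).
Proof.
move=> rr; have := canonicalP rr.
have [/andP[m0 mk] _] := andP rr.
move: (canonical1 r) (canonical2 r) => [m1 k1] [m2 k2] /= [p0 q0 e e1 e2].
case: r rr e m0 mk e1 e2 => m k /= rr [em ek] m0 mk e1 e2.
have det : m2 * k1 = m1 * k2 + 1 by nia.
split.
- apply/orP; have [k11|k11] := leqP k1 1.
    right; apply/orP; left; apply/eqP; congr pair; nia.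
  left; rewrite /reduced /= coprime_sym (@coprime_bezout _ _ m k) ?andbT; nia.
- apply/orP; have [k21|k21] := leqP k2 1.
    right; apply/orP; right; apply/eqP; congr pair; nia.
  left; rewrite /reduced /= (@coprime_bezout _ _ k m) ?andbT; nia.
- rewrite /slope ltr_pdivrMr ?ltr0n // mulrAC ltr_pdivlMr ?ltr0n //.
  by rewrite -!natrM ltr_nat /= det addn1.
- by rewrite /= det; lia.
Qed.

(** Substituting the mediant into the determinant of the pair turns it into
    [m p.2 - p.1 k = 1], which characterizes the first canonical parameter. *)
Lemma farey_canonical (p q r : param) : reduced r ->
  farey_adjacent p q -> mediant p q = r -> p = canonical1 r /\ q = canonical2 r.
Proof.
move=> rr [/admissible_gt0 p0 /admissible_gt0 q0 _ det] e.
have pE : p = canonical1 r.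
  by apply/canonical1P => //; rewrite -e /=; split; [lia | nia].
split=> //; rewrite /canonical2 -pE -e /=.
by rewrite !addKn; case: (q).
Qed.

(** * Splices of Farey parents, and rigidity *)

(** A number [x] whose multiple [l x] is known up to the error [c] modulo
    [l k] has residue [c / l] modulo [k]; with [l] a block denominator and [c]
    an integer angle, this is how a block reproduces the word of [r]. *)
Lemma scaled_modn (l k x a c : nat) : 0 < l ->
  l * x = l * (a * k) + c -> c < l * k -> c = l * (x %% k).
Proof.
move=> l0 e c_lt.
have xE : x = a * k + (x - a * k).
  by rewrite subnKC // -(leq_pmul2l l0) e leq_addr.
move: e; rewrite xE mulnDr => /addnI cE.
by rewrite modnMDl modn_small // -(ltn_pmul2l l0) cE.
Qed.

Lemma canonical_splice_equations (r : param) : reduced r ->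
  splice_equations (canonical1 r) (canonical2 r) r.
Proof.
move=> rr; have := canonicalP rr.
have [/andP[m0 mk] _] := andP rr.
move: (canonical1 r) (canonical2 r) => [m1 k1] [m2 k2] /= [p0 q0 e e1 e2].
case: r rr e m0 mk e1 e2 => m k /= rr [em ek] m0 mk e1 e2.
split=> /= [j jk1|i ik2].
  have := ltn_pmod (j * m1) p0; have := divn_eq (j * m1) k1.
  move: (_ %/ _) (_ %% _) => a s sE s_lt.
  by apply: (@scaled_modn _ _ _ a) => //; nia.
have := ltn_pmod (i * m2) q0; have := divn_eq (i * m2) k2.
move: (_ %/ _) (_ %% _) => b s sE s_lt.
by apply: (@scaled_modn _ _ _ (m1 + b)) => //; nia.
Qed.

Lemma splice_equations_canonical (p q r : param) : reduced r ->
    admissible p -> admissible q -> p.2 + q.2 = r.2 ->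
    splice_equations p q r ->
  [/\ p.2 = (canonical1 r).2, q.2 = (canonical2 r).2,
      (2 <= p.2 -> p = canonical1 r) & (2 <= q.2 -> q = canonical2 r)].
Proof.
move=> rr ap aq e [eq1 eq2].
have p0 := admissible_gt0 ap; have q0 := admissible_gt0 aq.
have [_ _ /(congr1 snd) sum2 e1 e2] := canonicalP rr.
have [/andP[m0 mk] co] := andP rr.
have k2 : 1 < r.2 by lia.
have inv_mod : p.2 * r.1 %% r.2 = 1.
  have := eq2 0 q0; rewrite mul0n mod0n muln0 add0n subn0 addn0 => h.
  by apply/eqP; rewrite -(eqn_pmul2l q0) -h muln1.
have p2E : p.2 = (canonical1 r).2.
  case: (modinvP k2 co) => _ _; apply; first by lia.
  by rewrite mulnC inv_mod modn_small.
have q2E : q.2 = (canonical2 r).2.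
  by apply/eqP; rewrite -(eqn_add2l p.2) e -sum2 p2E.
split=> // [p2|q2].
  have := eq1 1 p2; have /andP[/andP[_ lt_p] _] := admissible_reduced ap p2.
  rewrite !mul1n (modn_small lt_p) (modn_small mk) => h.
  by apply/canonical1P => //; split=> //; lia.
have := eq2 1 q2; have /andP[/andP[_ lt_q] _] := admissible_reduced aq q2.
rewrite mulnDl !mul1n -modnDml inv_mod (modn_small lt_q) => h.
(* If r.1 + 1 = r.2 the second edge has direction 0, leaving no room for the
   nonzero turn q.2 - 1 that the splice gives it. *)
have [lt_r|ge_r] := ltnP (1 + r.1) r.2; last first.
  by move: h; rewrite (_ : 1 + r.1 = r.2) ?modnn; lia.
move: h; rewrite modn_small // => h.
have : q.1 = (canonical2 r).1.
  by apply/eqP; rewrite -(eqn_pmul2l (ltnW k2)) e2 -q2E; lia.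
by move: q2E; case: (q) => ? ? /= -> ->.
Qed.

(** Counting edges gives [r.2 = p.2 + q.2 >= 2], so [r] cannot be a seed and
    rigidity applies; blocks of denominator 1 are normalized to the canonical
    seed, which turns rigidity into an equality of pairs. *)
Lemma reproduces_set_seeds (R : realType) (t : nat) (p q r : param) :
    0 < t -> admissible p -> admissible q -> admissible r ->
    reproduces R t p q r ->
  reduced r /\ set_seeds r (p, q) = (canonical1 r, canonical2 r).
Proof.
move=> t0 ap aq ar; have p0 := admissible_gt0 ap; have q0 := admissible_gt0 aq.
move/(reproducesP _ _ t0 p0 q0) => [e eqs].
have rr : reduced r by apply: admissible_reduced => //; lia.
have [p2E q2E pE qE] := splice_equations_canonical rr ap aq e eqs.
have set_seedE (c s : param) : s.2 = c.2 -> 0 < s.2 -> (2 <= s.2 -> s = c) ->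
    set_seed c s = c.
  move=> sE s0 sc; rewrite /set_seed; case: eqP => [s1|/eqP s1].
    by rewrite [RHS]surjective_pairing -sE s1.
  by apply: sc; lia.
by split=> //; rewrite /set_seeds /= !set_seedE.
Qed.

Theorem theorem5p1 (R : realType) (t m k : nat)
    (ht : 2 <= t) (hk : 2 <= k) (hm : 0 < m < k) (hmk : coprime m k) :
  let k1 := modinv m k in
  let m1 := (m * k1 - 1) %/ k in
  let m2 := m - m1 in
  let k2 := k - k1 in
  (* Farey parents *)
  [/\ farey_adjacent (m1, k1) (m2, k2),
      mediant (m1, k1) (m2, k2) = (m, k),
      (forall p q : param, farey_adjacent p q -> mediant p q = (m, k) ->
         p = (m1, k1) /\ q = (m2, k2))
    & reproduces R t (m1, k1) (m2, k2) (m, k)] /\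
  (* Rigidity *)
  (forall k1' m1' m2' : nat,
     let k2' := k - k1' in
     1 <= k1' <= k - 1 ->
     admissible (m1', k1') -> admissible (m2', k2') ->
     reproduces R t (m1', k1') (m2', k2') (m, k) ->
     [/\ k1' = k1, (2 <= k1' -> m1' = m1) & (2 <= k2' -> m2' = m2)]) /\
  (* Either seed realizes a block with denominator 1 *)
  (first_block R (t * k) t (0, 1) = first_block R (t * k) t (1, 1) /\
   second_block R (t * k) t (0, 1) = second_block R (t * k) t (1, 1)) /\
  (* Exactly one decomposition, the seeds not being distinguished *)
  (exists! pq : param * param,
     decomposition R t (m, k) pq /\ set_seeds (m, k) pq = pq) /\
  (* A splice within the family comes from a Farey-adjacent pair *)
  (forall p q r : param,
     admissible p -> admissible q -> admissible r ->
     reproduces R t p q r ->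
     farey_adjacent (set_seeds r (p, q)).1 (set_seeds r (p, q)).2).
Proof.
have rr : reduced (m, k) by rewrite /reduced /= hm.
have t0 : 0 < t by lia.
move=> k1 m1 m2 k2.
have farey : farey_adjacent (m1, k1) (m2, k2) := canonical_farey rr.
have [p0 q0 med _ _] := canonicalP rr.
have repr : reproduces R t (m1, k1) (m2, k2) (m, k).
  apply/reproducesP => //; split; first exact: (congr1 snd med).
  exact: (canonical_splice_equations rr).
have [adm1 adm2 _ _] := farey.
have admr : admissible (m, k) by rewrite /admissible rr.
split; first by split=> // p q; exact: farey_canonical.
split.
  move=> k1' m1' m2' k2' hk1' ap aq.
  move/(reproducesP _ _ t0 (admissible_gt0 ap) (admissible_gt0 aq)) => [e eqs].
  have [k1E _ m1E m2E] := splice_equations_canonical rr ap aq e eqs.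
  by split=> // [/m1E[]|/m2E[]].
split.
  by [].
split.
  exists ((m1, k1), (m2, k2)); split.
    split; first by split=> //; exact: (congr1 snd med).
    by case: (reproduces_set_seeds t0 adm1 adm2 admr repr).
  move=> [p q] [[ap aq _ re] <-].
  by case: (reproduces_set_seeds t0 ap aq admr re).
move=> p q r ap aq ar re.
by have [rr' ->] := reproduces_set_seeds t0 ap aq ar re; exact: canonical_farey.
Qed.
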